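(* Let $X=(X_n)_{n\in\mathbf{Z}}$ be an inhomogeneous constructive Markov chain governed by a sequence of random variables $V=(V_n)_{n\in\mathbf{Z}}$ and a sequence of measurable maps $(f_n)_{n\in\mathbf{Z}}$ (as defined in the context). Then the asymptotic $\sigma$-algebras $\mathcal{F}_{-\infty}^{(X,V)}$ and $\mathcal{F}_{-\infty}^{X}$ are equal.
   Context: All random variables are defined on a common probability space $(\Omega,\mathcal{A},P)$. Inhomogeneous constructive chain: for every $n\in\mathbf{Z}$, $X_n$ is a random variable with values in a measurable space $(E_n,\mathcal{E}_n)$; $V_{n+1}$ is a random variable with values in a measurable space $(G_{n+1},\mathcal{G}_{n+1})$, independent of the sequence $((X_k,V_k))_{k\le n}$; and $X_{n+1}=f_n(X_n,V_{n+1})$, where $f_n$ is a measurable map from $(E_n\times G_{n+1},\mathcal{E}_n\otimes\mathcal{G}_{n+1})$ to $(E_{n+1},\mathcal{E}_{n+1})$. For a sequence of random variables $(Y_n)_{n\in\mathbf{Z}}$, $\mathcal{F}^Y_n$ denotes the $P$-completion of $\sigma(Y_k: k\le n)$, and $\mathcal{F}^Y_{-\infty}=\bigcap_{n\in\mathbf{Z}}\mathcal{F}^Y_n$; for $Y=((X_n,V_n))_{n\in\mathbf{Z}}$ one writes $\mathcal{F}^{(X,V)}_n$ and $\mathcal{F}^{(X,V)}_{-\infty}$. All $\sigma$-algebras are assumed completed. *)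

(* Defs.v *)
From HB Require Import structures.
From mathcomp Require Import all_boot all_order all_algebra.
From mathcomp Require Import all_classical all_reals all_analysis.

Set Implicit Arguments.
Unset Strict Implicit.
Unset Printing Implicit Defensive.

Import Order.TTheory GRing.Theory Num.Theory.

Local Open Scope classical_set_scope.
Local Open Scope ring_scope.

Definition sigma_past (Omega : Type) (dS : int -> measure_display)
    (S : forall n : int, measurableType (dS n))
    (Y : forall n : int, Omega -> S n) (n : int) : set (set Omega) :=
  <<s \bigcup_(k in [set k : int | k <= n])
        preimage_set_system setT (Y k) measurable >>.

(* All null sets of the ambient space are adjoined, not only the subsets of
   null sets of the sigma-algebra being completed. *)
Definition completion (d : measure_display) (Omega : measurableType d)
    (R : realType) (P : probability Omega R) (F : set (set Omega)) :
    set (set Omega) :=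
  <<s F `|` P.-negligible >>.

Definition natural_filtration (d : measure_display) (Omega : measurableType d)
    (R : realType) (P : probability Omega R) (dS : int -> measure_display)
    (S : forall n : int, measurableType (dS n))
    (Y : forall n : int, Omega -> S n) (n : int) : set (set Omega) :=
  completion P (sigma_past Y n).

Definition asymptotic_sigma_algebra (d : measure_display)
    (Omega : measurableType d) (R : realType) (P : probability Omega R)
    (dS : int -> measure_display) (S : forall n : int, measurableType (dS n))
    (Y : forall n : int, Omega -> S n) : set (set Omega) :=
  \bigcap_(n in [set: int]) natural_filtration P Y n.

Definition independent_sigma_algebras (d : measure_display)
    (Omega : measurableType d) (R : realType) (P : probability Omega R)
    (F G : set (set Omega)) : Prop :=
  forall A B : set Omega, F A -> G B -> P (A `&` B) = (P A * P B)%E.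

Definition joint (Omega : Type) (dE dG : int -> measure_display)
    (E : forall n : int, measurableType (dE n))
    (G : forall n : int, measurableType (dG n))
    (X : forall n : int, Omega -> E n) (V : forall n : int, Omega -> G n)
    (n : int) (w : Omega) : (E n * G n)%type :=
  (X n w, V n w).

Record inhomogeneous_constructive_chain (d : measure_display)
    (Omega : measurableType d) (R : realType) (P : probability Omega R)
    (dE dG : int -> measure_display)
    (E : forall n : int, measurableType (dE n))
    (G : forall n : int, measurableType (dG n))
    (X : forall n : int, {RV P >-> E n}) (V : forall n : int, {RV P >-> G n})
    (f : forall n : int, E n * G (n + 1) -> E (n + 1)) : Prop := {
  chain_measurable : forall n : int, measurable_fun [set: E n * G (n + 1)] (f n);
  chain_independent : forall n : int,
    independent_sigma_algebras P
      (g_sigma_algebra_preimage (V (n + 1)))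
      (sigma_past (joint X V) n);
  chain_recursion : forall (n : int) (w : Omega),
    X (n + 1) w = f n (X n w, V (n + 1) w) }.

(* Main.v *)
Require Import Defs.
From HB Require Import structures.
From mathcomp Require Import all_boot all_order all_algebra.
From mathcomp Require Import all_classical all_reals all_analysis.
Set Implicit Arguments.
Unset Strict Implicit.
Unset Printing Implicit Defensive.
Import Order.TTheory GRing.Theory Num.Theory.
Local Open Scope classical_set_scope.
Local Open Scope ring_scope.

(** The inclusion of the asymptotic sigma-algebra of [X] in that of [(X, V)]
    only uses monotonicity. For the converse, let [A] be asymptotic for
    [(X, V)] and fix a time [n]; up to a null set, [A] belongs to the
    uncompleted past of [(X, V)] at every time.

    For [m <= n] let [window m n] be the sigma-algebra generated by [X m] and
    the innovations [V (m + 1), ..., V n]. The recursion makes it grow as [m]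
    decreases ([window_homo]), and the union over [m] is an algebra generating
    the past of [(X, V)] at time [n] ([past_joint_sub_window]). Hence, for every
    [e > 0], some [B] in some [window m n] satisfies [P (A `+` B) < e]
    ([approximable_sigma]).

    The set [A] also belongs to the past at time [m], and each innovation
    occurring in [B] is independent of all that precedes it. By Fubini, [P (A
    `+` B)] is the average, over the values [v] of the last innovation, of [P
    (A `+` B_v)], where [B_v] is obtained from [B] by freezing that innovation
    at [v]; so for some [v] one has [P (A `+` B_v) < e]
    ([independent_generator_removal]). Freezing the innovations one after the
    other leaves a set of the sigma-algebra of [X m] alone
    ([window_approx_present]). Thus [A] is approximated, within every [e > 0],
    by events of the past of [X] at time [n], and by the Borel-Cantelli lemma
    it coincides with one of them up to a null set ([approximable_ae_mem]). *)

(** * Symmetric differences, completion and approximation *)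

Lemma sub_gen_sigma (T : Type) (S S' : set (set T)) :
  S `<=` <<s S' >> -> <<s S >> `<=` <<s S' >>.
Proof.
by move=> SS'; apply: smallest_sub => //; exact: smallest_sigma_algebra.
Qed.

Lemma measurableY (d : measure_display) (T : measurableType d) (A B : set T) :
  measurable A -> measurable B -> measurable (A `+` B).
Proof.
by move=> mA mB; rewrite setY_def; apply: measurableU; exact: measurableD.
Qed.

Lemma setYCC (T : Type) (A B : set T) : ~` A `+` ~` B = A `+` B.
Proof.
rewrite !setY_def; apply/seteqP; split => x /=;
by have [?|?] := pselect (A x); have [?|?] := pselect (B x); tauto.
Qed.

Lemma negligible_setY_trans (d : measure_display) (Omega : measurableType d)
    (R : realType) (P : probability Omega R) (A B C : set Omega) :
  P.-negligible (A `+` B) -> P.-negligible (B `+` C) ->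
  P.-negligible (A `+` C).
Proof.
move=> nAB nBC; apply: negligibleS (negligibleU nAB nBC) => x.
by rewrite !setY_def /=; have [?|?] := pselect (B x); tauto.
Qed.

Lemma measure_setY_triangle (d : measure_display) (Omega : measurableType d)
    (R : realType) (P : probability Omega R) (A B C : set Omega) :
  measurable A -> measurable B -> measurable C ->
  (P (A `+` C) <= P (A `+` B) + P (B `+` C))%E.
Proof.
move=> mA mB mC; have mAB := measurableY mA mB; have mBC := measurableY mB mC.
apply: le_trans (measureU2 _ _ _) => //.
apply: le_measure; rewrite ?inE; [exact: measurableY|exact: measurableU|].
move=> x; rewrite !setY_def /=.
by have [?|?] := pselect (B x); tauto.
Qed.

Lemma completion_mono (d : measure_display) (Omega : measurableType d)
    (R : realType) (P : probability Omega R) (F F' : set (set Omega)) :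
  F `<=` F' -> completion P F `<=` completion P F'.
Proof.
move=> FF'; apply: sub_gen_sigma => A [FA|NA]; apply: sub_sigma_algebra.
  by left; exact: FF'.
by right.
Qed.

(** The completion of a sigma-algebra consists of the sets that differ from one
    of its members by a negligible set. *)
Lemma completionP (d : measure_display) (Omega : measurableType d)
    (R : realType) (P : probability Omega R) (F : set (set Omega))
    (A : set Omega) :
  sigma_algebra setT F ->
  completion P F A <-> exists2 B, F B & P.-negligible (A `+` B).
Proof.
move=> [F0 FC FU]; split.
- move: A; apply: smallest_sub; last first.
    move=> A [FA|NA]; last by exists set0 => //; rewrite setY0.
    by exists A => //; rewrite setYK; exact: negligible_set0.
  split.
  + by exists set0 => //; rewrite setYK; exact: negligible_set0.
  + move=> A [B FB AB]; exists (setT `\` B); first exact: FC.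
    by rewrite !setTD setYCC.
  + move=> A AB; pose B n := sval (cid2 (AB n)).
    exists (\bigcup_n B n); first by apply: FU => n; rewrite /B; case: cid2.
    have : P.-negligible (\bigcup_n (A n `+` B n)).
      by apply: negligible_bigcup => n; rewrite /B; case: cid2.
    apply: negligibleS => x.
    rewrite setY_def => -[[[n _ Anx] nBx]|[[n _ Bnx] nAx]];
      exists n => //; rewrite setY_def.
      by left; split => // Bnx; apply: nBx; exists n.
    by right; split => // Anx; apply: nAx; exists n.
- move=> [B FB NAB].
  have NAB' C : C `<=` A `+` B -> completion P F C.
    by move=> CAB; apply: sub_sigma_algebra; right; exact: negligibleS NAB.
  have -> : A = (B `\` (B `\` A)) `|` (A `\` B).
    apply/seteqP; split => x /=;
    by have [?|?] := pselect (A x); have [?|?] := pselect (B x); tauto.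
  apply: (@measurableU _ (g_sigma_algebraType (F `|` P.-negligible))).
    apply: (@measurableD _ (g_sigma_algebraType (F `|` P.-negligible))).
      by apply: sub_sigma_algebra; left.
    by apply: NAB' => x; rewrite setY_def; right.
  by apply: NAB' => x; rewrite setY_def; left.
Qed.

(** [A] is a limit of elements of [F] for the pseudo-distance
    [P (A `+` B)]. *)
Definition approximable (d : measure_display) (Omega : measurableType d)
    (R : realType) (P : probability Omega R) (F : set (set Omega))
    (A : set Omega) : Prop :=
  forall e : R, 0 < e -> exists2 B, F B & (P (A `+` B) < e%:E)%E.

(** An algebra of events is dense, for this pseudo-distance, in the
    sigma-algebra that it generates: the approximable events form a
    sigma-algebra. *)
Lemma approximable_sigma (d : measure_display) (Omega : measurableType d)
    (R : realType) (P : probability Omega R) (F : set (set Omega)) :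
  F `<=` measurable -> F set0 -> setC_closed F -> setU_closed F ->
  <<s F >> `<=` approximable P F.
Proof.
move=> mF F0 FC FU.
suff: <<s F >> `<=` [set A | measurable A /\ approximable P F A].
  by move=> H A /H[].
apply: smallest_sub; last first.
  move=> A FA; split; first exact: mF.
  by move=> e e0; exists A => //; rewrite setYK measure0.
have cU A B : measurable A /\ approximable P F A ->
    measurable B /\ approximable P F B ->
    measurable (A `|` B) /\ approximable P F (A `|` B).
  move=> [mA aA] [mB aB]; split; first exact: measurableU.
  move=> e e0; have e20 : 0 < e / 2 by exact: divr_gt0.
  have [A' FA' AA'] := aA _ e20; have [B' FB' BB'] := aB _ e20.
  exists (A' `|` B'); first exact: FU.
  have mA' := mF _ FA'; have mB' := mF _ FB'.
  have mAA' := measurableY mA mA'; have mBB' := measurableY mB mB'.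
  apply: (@le_lt_trans _ _ (P ((A `+` A') `|` (B `+` B')))).
    apply: le_measure; rewrite ?inE.
    - by apply: measurableY; exact: measurableU.
    - exact: measurableU.
    - by move=> x; rewrite !setY_def /=; tauto.
  apply: le_lt_trans (measureU2 _ _ _) _ => //.
  by rewrite [e]splitr EFinD; exact: lteD.
split.
- by split=> // e e0; exists set0 => //; rewrite setYK measure0.
- move=> A [mA aA]; rewrite setTD; split; first exact: measurableC.
  move=> e e0; have [B FB AB] := aA e e0; exists (~` B); first exact: FC.
  by rewrite setYCC.
- (* The union is approximated by a finite partial union, by continuity of [P]
     from above along the decreasing differences, and that partial union by an
     element of [F]. *)
  move=> A HA.
  pose U n := \big[setU/set0]_(i < n) A i.
  have HU n : measurable (U n) /\ approximable P F (U n).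
    rewrite /U; elim: n => [|n IH].
      rewrite big_ord0; split=> // e e0.
      by exists set0 => //; rewrite setYK measure0.
    by rewrite big_ord_recr /=; apply: cU => //; exact: HA.
  have mU : measurable (\bigcup_n A n).
    by apply: bigcup_measurable => n _; case: (HA n).
  split=> // e e0; have e20 : 0 < e / 2 by exact: divr_gt0.
  have [n PUn] : exists n, (P ((\bigcup_n A n) `+` U n) < (e / 2)%:E)%E.
    have Usub n : U n `<=` \bigcup_n A n by exact: bigsetU_bigcup.
    have Ucap : \bigcap_n ((\bigcup_n A n) `\` U n) = set0.
      apply/seteqP; split => // x H; have [[k _ Akx] _] := H 0%N I.
      by have [_] := H k.+1 I; apply; rewrite /U big_ord_recr /=; right.
    have mD n : measurable ((\bigcup_n A n) `\` U n).
      by apply: measurableD => //; case: (HU n).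
    have cv : (P \o (fun n => (\bigcup_n A n) `\` U n)) n @[n --> \oo]
        --> P set0.
      rewrite -Ucap; apply: nonincreasing_cvg_mu => //.
      - by rewrite -ge0_fin_numE ?fin_num_measure.
      - by rewrite Ucap.
      - move=> n m nm; apply/subsetPset => x [Ax nUx]; split => // Ux.
        by apply: nUx; exact: (subset_bigsetU nm).
    have [|n _ /(_ n (leqnn n)) /= Hn] :=
      cv _ (@open_ereal_lt' _ _ (e / 2)%:E _).
      by rewrite measure0 lte_fin.
    exists n; rewrite setY_def.
    suff -> : U n `\` \bigcup_n A n = set0 by rewrite setU0.
    by rewrite setD_eq0.
  have [B FB UB] := (HU n).2 _ e20; exists B => //.
  apply: le_lt_trans (measure_setY_triangle P mU (HU n).1 (mF _ FB)) _.
  by rewrite [e]splitr EFinD; exact: lteD.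
Qed.

(** A sigma-algebra is closed, up to null sets, for the pseudo-distance: if
    [P (A `+` B n) <= 2 ^- n.+1] for all [n], then by the Borel-Cantelli lemma
    [A] agrees almost surely with the upper limit of the [B n]. *)
Lemma approximable_ae_mem (d : measure_display) (Omega : measurableType d)
    (R : realType) (P : probability Omega R) (F : set (set Omega))
    (A : set Omega) :
  sigma_algebra setT F -> F `<=` measurable -> measurable A ->
  approximable P F A -> exists2 B, F B & P (A `+` B) = 0%E.
Proof.
move=> [F0 FC FU] mF mA aA.
have FC' B : F B -> F (~` B) by move=> /FC; rewrite setTD.
have e0 n : 0 < 1 / (2 ^ n.+1)%:R :> R by rewrite divr_gt0// ltr0n expn_gt0.
pose B n := sval (cid2 (aA _ (e0 n))).
have FB n : F (B n) by rewrite /B; case: cid2.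
have PB n : (P (A `+` B n) <= (1 / (2 ^ n.+1)%:R)%:E)%E.
  by rewrite /B; case: cid2 => //= ? ? /ltW.
have mAB n : measurable (A `+` B n) by apply: measurableY => //; exact: mF.
have FB' : F (lim_sup_set B).
  rewrite /lim_sup_set -(setCK (\bigcap_n _)) setC_bigcap; apply: (FC').
  apply: (FU) => n; apply: FC'.
  suff -> : \bigcup_(k in [set k | (n <= k)%N]) B k = \bigcup_k B (n + k)%N.
    exact: FU.
  apply/seteqP; split => x [k].
    by move=> /= nk Bx; exists (k - n)%N => //; rewrite subnKC.
  by move=> _ Bx; exists (n + k)%N => //=; rewrite leq_addr.
exists (lim_sup_set B) => //.
have H0 : P (lim_sup_set (fun n => A `+` B n)) = 0%E.
  apply: lim_sup_set_cvg0 => //.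
  apply: (@le_lt_trans _ _ 1%E); last by rewrite ltry.
  apply: le_trans (epsilon_trick0 _ _) => //.
  by apply: lee_nneseries => n _; [|exact: PB].
apply/eqP; rewrite -measure_le0 -H0; apply: le_measure; rewrite ?inE.
- by apply: measurableY => //; exact: mF.
- apply: bigcap_measurable; first by exists 0%N.
  by move=> n _; exact: bigcup_measurable.
- move=> x; rewrite setY_def => -[[Ax nCx]|[Cx nAx]] n _.
    have /existsNP[m /not_implyP[_ nBx]] := nCx.
    exists (maxn n m); first exact: leq_maxl.
    rewrite setY_def; left; split => // Bx; apply: nBx.
    by exists (maxn n m) => //; exact: leq_maxr.
  by have [k nk Bx] := Cx n I; exists k => //; rewrite setY_def; right.
Qed.

(** * Freezing an independent variable *)

(** Let [V] be independent of a sigma-algebra containing [A] and [S'], and let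
    [B] be described by [S'] and [V]. Then the dependence of [B] on [V] can be
    removed without loss in the approximation of [A]: writing [B] as the set of
    [w] with [(V w, w)] in [C], Fubini for the independent pair of [V] and the
    identity expresses [P (A `+` B)] as the average of [P (A `+` C_v)] over the
    law of [V], so some section [C_v] does at least as well as required. *)
Lemma independent_generator_removal (d : measure_display)
    (Omega : measurableType d) (R : realType) (P : probability Omega R)
    (d' : measure_display) (T : measurableType d') (V : {RV P >-> T})
    (S S' : set (set Omega)) (A B : set Omega) (e : \bar R) :
  <<s S >> `<=` measurable -> S' `<=` <<s S >> ->
  independent_sigma_algebras P (g_sigma_algebra_preimage V) <<s S >> ->
  <<s S >> A -> <<s S' `|` g_sigma_algebra_preimage V >> B ->
  (P (A `+` B) < e)%E -> exists2 B', <<s S' >> B' & (P (A `+` B') < e)%E.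
Proof.
move=> mSS S'S ind SA SVB PAB.
have S'S' := sub_gen_sigma S'S.
have [C mC BE] : preimage_set_system setT
    (fun w : Omega => (V w, w) : T * g_sigma_algebraType S') measurable B.
  move: B SVB {PAB}; apply: smallest_sub.
    by apply: sigma_algebra_preimage; exact: sigma_algebra_measurable.
  move=> B [S'B|[U mU <-]].
  - exists (setT `*` B).
      by apply: measurableX => //; exact: sub_sigma_algebra.
    by apply/seteqP; split => x //= [? []].
  - exists (U `*` setT); first exact: measurableX.
    by apply/seteqP; split => x //=; tauto.
(* The set [A] need not be measurable for [S'], so the product measure lives on
   the larger sigma-algebra generated by [S]. *)
have mid : measurable_fun setT (fun w : Omega => w : g_sigma_algebraType S).
  by move=> _ Y mY; rewrite setTI; exact: mSS.
have mh : measurable_fun setT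
    (fun w : Omega => (V w, w) : T * g_sigma_algebraType S).
  exact: measurable_fun_pair.
pose h : {mfun Omega >-> (T * g_sigma_algebraType S)%type} :=
  mfun_Sub (mem_set mh).
pose i : {mfun Omega >-> g_sigma_algebraType S} := mfun_Sub (mem_set mid).
have mC' : measurable (C : set (T * g_sigma_algebraType S)).
  move: C mC {BE}; apply: smallest_sub.
    exact: (@sigma_algebra_measurable _ (T * g_sigma_algebraType S)%type).
  move=> Y [[U mU <-]|[U mU <-]].
    by apply: sub_sigma_algebra; left; exists U.
  by apply: sub_sigma_algebra; right; exists U => //; exact: S'S'.
pose D : set (T * g_sigma_algebraType S) := (setT `*` A) `+` C.
have mD : measurable D.
  by apply: measurableY => //; exact: measurableX.
have xD v : xsection D v = A `+` xsection C v.
  rewrite /D !setY_def; apply/seteqP.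
  by split => x /=; rewrite /xsection /= !inE /=; tauto.
have PD : (P (A `+` B) = \int[distribution P V]_v P (A `+` xsection C v))%E.
  transitivity (distribution P h D).
    congr (P _); rewrite -BE /D !setY_def /=; apply/seteqP.
    by split => x /=; tauto.
  rewrite -(@product_measure_unique _ _ _ _ _
    (distribution P V) (distribution P i)) //.
    by apply: eq_integral => v _ /=; rewrite xD.
  move=> U Y mU mY; rewrite /distribution /pushforward /=.
  rewrite -ind; last 2 first.
    by exists U => //; rewrite setTI.
    exact: mY.
  by congr (P _); apply/seteqP; split => x.
have [[v Hv]|noV] := pselect (exists v, (P (A `+` xsection C v) < e)%E).
  exists (xsection C v) => //.
  exact: (@measurable_xsection _ _ T (g_sigma_algebraType S')).
have e0 : (0 <= e)%E.
  by apply: ltW; apply: le_lt_trans PAB; exact: measure_ge0.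
exfalso; move: PAB; apply/negP; rewrite -leNgt PD.
rewrite -[leLHS]mule1 -(probability_setT (distribution P V)) -integral_cst //.
apply: ge0_le_integral => //.
- have := measurable_fun_xsection (distribution P i) mD.
  by congr (measurable_fun _ _); apply/funext => v /=; rewrite xD.
- by move=> v _; rewrite leNgt; apply/negP => ?; apply: noV; exists v.
Qed.

(** * Pasts and windows *)

Lemma g_sigma_preimage_pair (d d1 d2 : measure_display)
    (Omega : measurableType d)
    (T1 : measurableType d1) (T2 : measurableType d2)
    (f : Omega -> T1) (g : Omega -> T2) :
  <<s g_sigma_algebra_preimage f `|` g_sigma_algebra_preimage g >>
  = preimage_set_system setT (fun w => (f w, g w)) measurable.
Proof. exact: (g_sigma_preimageU_comp fst snd (fun w => (f w, g w))). Qed.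

Lemma sigma_past_measurable (d : measure_display) (Omega : measurableType d)
    (dS : int -> measure_display) (S : forall n : int, measurableType (dS n))
    (Y : forall n, Omega -> S n) n :
  (forall k, measurable_fun setT (Y k)) -> sigma_past Y n `<=` measurable.
Proof.
move=> mY; apply: smallest_sub; first exact: sigma_algebra_measurable.
by move=> A [k _ [B mB <-]]; exact: mY.
Qed.

Lemma sigma_past_homo (Omega : Type) (dS : int -> measure_display)
    (S : forall n : int, measurableType (dS n)) (Y : forall n, Omega -> S n)
    m n :
  m <= n -> sigma_past Y m `<=` sigma_past Y n.
Proof.
move=> mn; apply: sub_gen_sigma => A [k km YA]; apply: sub_sigma_algebra.
by exists k => //=; exact: le_trans mn.
Qed.

Section chain.
Context (d : measure_display) (Omega : measurableType d)
    (R : realType) (P : probability Omega R)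
    (dE dG : int -> measure_display)
    (E : forall n : int, measurableType (dE n))
    (G : forall n : int, measurableType (dG n))
    (X : forall n : int, {RV P >-> E n}) (V : forall n : int, {RV P >-> G n}).

(** The events described by [X m], or by one [V k] with [m < k <= n]. *)
Definition window_gen (m n : int) : set (set Omega) :=
  g_sigma_algebra_preimage (X m) `|`
  \bigcup_(k in [set k : int | m < k <= n]) g_sigma_algebra_preimage (V k).

(** The sigma-algebra generated by [X m] and the [V k] with [m < k <= n]. For
    [n <= m] it reduces to the sigma-algebra of [X m]. *)
Definition window (m n : int) : set (set Omega) := <<s window_gen m n >>.

Lemma window_genS m n : m <= n ->
  window_gen m (n + 1) =
  window_gen m n `|` g_sigma_algebra_preimage (V (n + 1)).
Proof.
move=> mn; apply/seteqP; split => A.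
  move=> [XA|[k /= /andP[mk]]]; first by left; left.
  rewrite le_eqVlt => /orP[/eqP -> VA|kn VA]; first by right.
  by left; right; exists k => //=; rewrite mk -ltzD1.
move=> [[XA|[k /= /andP[mk kn] VA]]|VA]; first by left.
  by right; exists k => //=; rewrite mk (le_trans kn) // lerDl.
by right; exists (n + 1) => //=; rewrite lexx andbT ltzD1.
Qed.

Lemma window_gen_diag m : window_gen m m = g_sigma_algebra_preimage (X m).
Proof.
apply/seteqP; split => A; last by left.
by move=> [//|[k /= /andP[mk km]]]; have := lt_le_trans mk km; rewrite ltxx.
Qed.

Lemma window_measurable m n : window m n `<=` measurable.
Proof.
apply: smallest_sub; first exact: sigma_algebra_measurable.
by move=> A [[B mB <-]|[k _ [B mB <-]]]; exact: measurable_funPT.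
Qed.

Lemma past_joint_measurable n : sigma_past (joint X V) n `<=` measurable.
Proof. by apply: sigma_past_measurable => k; exact: measurable_fun_pair. Qed.

Lemma window_sub_past m n : m <= n -> window m n `<=` sigma_past (joint X V) n.
Proof.
move=> mn; apply: sub_gen_sigma => A [XA|[k /= /andP[_ kn] VA]];
  apply: sub_sigma_algebra.
  exists m => //; rewrite /joint -g_sigma_preimage_pair.
  by apply: sub_sigma_algebra; left.
exists k => //; rewrite /joint -g_sigma_preimage_pair.
by apply: sub_sigma_algebra; right.
Qed.

Lemma past_sub_past_joint n : sigma_past X n `<=` sigma_past (joint X V) n.
Proof.
apply: sub_gen_sigma => A [k kn XA]; apply: sub_sigma_algebra; exists k => //.
by rewrite /joint -g_sigma_preimage_pair; apply: sub_sigma_algebra; left.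
Qed.

Lemma preimage_sub_past n m :
  m <= n -> g_sigma_algebra_preimage (X m) `<=` sigma_past X n.
Proof. by move=> mn A XA; apply: sub_sigma_algebra; exists m. Qed.

Lemma past_joint_sub_window n :
  sigma_past (joint X V) n `<=` <<s \bigcup_k window (n - k%:Z) n >>.
Proof.
have Hw m : m <= n -> window m n `<=` \bigcup_k window (n - k%:Z) n.
  move=> mn A wA; exists `|n - m|%N => //=.
  by rewrite gez0_abs ?subr_ge0// subKr.
apply: sub_gen_sigma => A [k /= kn]; rewrite /joint -g_sigma_preimage_pair.
apply: sub_gen_sigma => {}A [XA|VA]; apply: sub_sigma_algebra.
  by apply: (Hw k) => //; apply: sub_sigma_algebra; left.
(* [V k] only enters the windows starting strictly before [k]. *)
apply: (Hw (k - 1)); first by rewrite (le_trans _ kn)// lerBlDr lerDl.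
apply: sub_sigma_algebra; right; exists k => //=.
by rewrite kn andbT ltrBlDr ltrDl.
Qed.

Context (f : forall n : int, E n * G (n + 1) -> E (n + 1))
    (chainXVf : inhomogeneous_constructive_chain X V f).

Lemma chain_preimage n : g_sigma_algebra_preimage (X (n + 1)) `<=`
  <<s g_sigma_algebra_preimage (X n) `|`
      g_sigma_algebra_preimage (V (n + 1)) >>.
Proof.
move=> _ [B mB <-]; rewrite g_sigma_preimage_pair.
exists (@f n @^-1` B).
  by rewrite -[X in measurable X]setTI; exact: (chain_measurable chainXVf).
by apply/seteqP; split => w /=; rewrite (chain_recursion chainXVf).
Qed.

Lemma window_pred m n : m < n -> window (m + 1) n `<=` window m n.
Proof.
move=> mn; apply: sub_gen_sigma => A [|[k /= /andP[mk kn] VA]].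
  move/chain_preimage; apply: sub_gen_sigma => {}A [XA|VA].
    by apply: sub_sigma_algebra; left.
  apply: sub_sigma_algebra; right; exists (m + 1) => //=.
  by rewrite ltzD1 lexx -ltzD1 ltrD2r.
apply: sub_sigma_algebra; right; exists k => //=.
by rewrite kn andbT (lt_trans _ mk)// ltzD1.
Qed.

Lemma window_homo n (i j : nat) : (i <= j)%N ->
  window (n - i%:Z) n `<=` window (n - j%:Z) n.
Proof.
move=> /subnK <-; elim: (j - i)%N => // k IH.
apply: subset_trans IH _; rewrite addSn.
have -> : n - (k + i)%:Z = (n - (k + i).+1%:Z) + 1.
  by rewrite -addn1 [in RHS]PoszD opprD addrA subrK.
by apply: window_pred; rewrite ltrBlDr ltrDl.
Qed.

(** * Comparison of the asymptotic sigma-algebras *)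

(** An event of the past at time [m] is approximated by events of the
    sigma-algebra of [X m] as well as by events of any window starting at [m],
    since each later innovation is independent of all that precedes it, so that
    the innovations can be frozen from the last one to the first. *)
Lemma window_approx_present (A B : set Omega) (e : \bar R) m k :
  sigma_past (joint X V) m A -> window m (m + k%:Z) B -> (P (A `+` B) < e)%E ->
  exists2 B', g_sigma_algebra_preimage (X m) B' & (P (A `+` B') < e)%E.
Proof.
move=> FA; elim: k B => [|k IH] B.
  rewrite addr0 /window window_gen_diag => wB PB; exists B => //.
  move: wB; apply: smallest_sub => //.
  by apply: sigma_algebra_preimage; exact: sigma_algebra_measurable.
rewrite -addn1 PoszD addrA /window window_genS ?lerDl// => wB PB.
have mFA : sigma_past (joint X V) (m + k%:Z) A.
  by apply: sigma_past_homo FA; rewrite lerDl.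
have [B' wB' PB'] : exists2 B', window m (m + k%:Z) B' & (P (A `+` B') < e)%E.
  have mpast := @past_joint_measurable (m + k%:Z).
  have ind := chain_independent chainXVf (n := m + k%:Z).
  have wpast : window m (m + k%:Z) `<=` sigma_past (joint X V) (m + k%:Z).
    by apply: window_sub_past; rewrite lerDl.
  rewrite /sigma_past in mFA mpast ind wpast.
  apply: (independent_generator_removal mpast _ ind mFA wB PB).
  by apply: subset_trans wpast; exact: sub_sigma_algebra.
exact: IH wB' PB'.
Qed.

Lemma asymptotic_joint_sub :
  asymptotic_sigma_algebra P (joint X V) `<=` asymptotic_sigma_algebra P X.
Proof.
move=> A asyA n _.
(* The representative of [A] in the uncompleted past depends on the time. *)
have /choice[A_ A_P] m : exists B,
    sigma_past (joint X V) m B /\ P.-negligible (A `+` B).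
  have /completionP[|B FB AB] := asyA m I; first exact: smallest_sigma_algebra.
  by exists B.
have mA_ m : measurable (A_ m).
  by apply: past_joint_measurable; exact: (A_P m).1.
have PA_ m m' : P (A_ m `+` A_ m') = 0%E.
  apply: measure_negligible; first exact: measurableY.
  apply: (negligible_setY_trans (B := A)); last exact: (A_P m').2.
  by rewrite setYC; exact: (A_P m).2.
have A_swap m m' B e : measurable B ->
    (P (A_ m `+` B) < e)%E -> (P (A_ m' `+` B) < e)%E.
  move=> mB; apply: le_lt_trans.
  apply: le_trans (measure_setY_triangle P (mA_ m') (mA_ m) mB) _.
  by rewrite PA_ add0e.
have aA : approximable P (sigma_past X n) (A_ n).
  move=> e e0.
  have Wle i j := @window_homo n i j.
  pose W := \bigcup_k window (n - k%:Z) n.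
  have aW : <<s W >> `<=` approximable P W.
    apply: approximable_sigma.
    - by move=> B [k _]; exact: window_measurable.
    - exists 0%N => //.
      by case: (@smallest_sigma_algebra _ setT (window_gen (n - 0%:Z) n)).
    - move=> B [k _ wB]; exists k => //.
      exact: (@measurableC _ (g_sigma_algebraType (window_gen (n - k%:Z) n))).
    - move=> B B' [k _ wB] [k' _ wB']; exists (maxn k k') => //.
      apply: (@measurableU _
        (g_sigma_algebraType (window_gen (n - (maxn k k')%:Z) n))).
        by apply: (Wle k) => //; exact: leq_maxl.
      by apply: (Wle k') => //; exact: leq_maxr.
  have [B [k _ wB] PB] := aW _ (past_joint_sub_window (A_P n).1) e e0.
  have PB' := A_swap n (n - k%:Z) _ _ (window_measurable wB) PB.
  have [|B' XB' PB''] := @window_approx_present (A_ (n - k%:Z)) B e%:E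
    (n - k%:Z) k (A_P _).1 _ PB'.
    by rewrite subrK.
  exists B'; first by apply: preimage_sub_past XB'; rewrite lerBlDr lerDl.
  by apply: A_swap PB''; case: XB' => C mC <-; exact: measurable_funPT.
have [||B FB PB] := approximable_ae_mem _ _ (mA_ n) aA.
- exact: smallest_sigma_algebra.
- by apply: sigma_past_measurable => k.
apply/completionP; first exact: smallest_sigma_algebra.
exists B => //; apply: negligible_setY_trans (A_P n).2 _.
apply/negligibleP => //; apply: measurableY => //.
by move: FB; apply: sigma_past_measurable => k.
Qed.

End chain.

Theorem proposition1 (d : measure_display) (Omega : measurableType d)
    (R : realType) (P : probability Omega R)
    (dE dG : int -> measure_display)
    (E : forall n : int, measurableType (dE n))
    (G : forall n : int, measurableType (dG n))
    (X : forall n : int, {RV P >-> E n}) (V : forall n : int, {RV P >-> G n})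
    (f : forall n : int, E n * G (n + 1) -> E (n + 1))
    (chainXVf : inhomogeneous_constructive_chain X V f) :
  asymptotic_sigma_algebra P (joint X V) = asymptotic_sigma_algebra P X.
Proof.
apply/seteqP; split; first exact: asymptotic_joint_sub chainXVf.
move=> A asyA n _; move: (asyA n I).
by apply: completion_mono; exact: past_sub_past_joint.
Qed.
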